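(* There exists a Bernstein set $B\subseteq\mathbb R^2$ which is not a $3$-I-covering.
   Context: A set $B\subseteq\mathbb R^2$ is a Bernstein set if for every uncountable Borel $Z\subseteq\mathbb R^2$ both $Z\cap B$ and $Z\setminus B$ are nonempty. A set $A\subseteq\mathbb R^2$ is a $3$-I-covering if for every $C\subseteq\mathbb R^2$ with $|C|=3$ there is an isometry $\phi$ of the Euclidean plane with $\phi[C]\subseteq A$. *)

(* Defs.v *)
From Stdlib Require Import Reals.
Open Scope R_scope.

Definition pt := (R * R)%type.

Definition dist2 (p q : pt) : R :=
  sqrt ((fst p - fst q) ^ 2 + (snd p - snd q) ^ 2).

Definition open2 (U : pt -> Prop) : Prop :=
  forall p, U p -> exists eps, 0 < eps /\ forall q, dist2 p q < eps -> U q.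

Definition sigma_algebra2 (S : (pt -> Prop) -> Prop) : Prop :=
  S (fun _ => True) /\
  (forall A, S A -> S (fun x => ~ A x)) /\
  (forall F : nat -> pt -> Prop, (forall n, S (F n)) -> S (fun x => exists n, F n x)).

Definition borel2 (Z : pt -> Prop) : Prop :=
  forall S, sigma_algebra2 S -> (forall U, open2 U -> S U) -> S Z.

Definition countable_set (Z : pt -> Prop) : Prop :=
  exists f : pt -> nat, forall x y, Z x -> Z y -> f x = f y -> x = y.

Definition uncountable_set (Z : pt -> Prop) : Prop := ~ countable_set Z.

Definition bernstein (B : pt -> Prop) : Prop :=
  forall Z, borel2 Z -> uncountable_set Z ->
    (exists x, Z x /\ B x) /\ (exists x, Z x /\ ~ B x).

(* isometry of the Euclidean plane: a distance-preserving self-map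
   (such maps are automatically bijective) *)
Definition isometry2 (phi : pt -> pt) : Prop :=
  forall p q, dist2 (phi p) (phi q) = dist2 p q.

Definition card3 (C : pt -> Prop) : Prop :=
  exists a b c, a <> b /\ a <> c /\ b <> c /\
    forall x, C x <-> (x = a \/ x = b \/ x = c).

Definition three_I_covering (A : pt -> Prop) : Prop :=
  forall C, card3 C -> exists phi, isometry2 phi /\ forall x, C x -> A (phi x).

(* Main.v *)
(* Let the forbidden configuration be the equilateral triangle of side 1.  Borel sets
   are analytic, so they are coded by points of [2^nat], and an uncountable analytic
   set contains an injective image of [2^nat].  Well-order the codes so that every
   proper initial segment is smaller than the continuum, and pick by transfinite
   recursion in the i-th uncountable analytic set a point [x_i] put into [B] and a point
   [y_i] kept out of [B], where [x_i] completes no unit triangle with two earlier [x_j].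
   Such an [x_i] exists because two distinct unit circles meet in at most two points. *)

Require Import Defs.
From Stdlib Require Import Reals Lra Lia Arith Cantor.
From Stdlib Require Import Classical ClassicalEpsilon FunctionalExtensionality.
From Stdlib Require Import ProofIrrelevance Wellfounded.
From mathcomp Require boolp wochoice.

(** * The Euclidean metric on the plane *)

Lemma dist2_euc p q : dist2 p q = dist_euc (fst p) (snd p) (fst q) (snd q).
Proof. unfold dist2, dist_euc, Rsqr. f_equal; ring. Qed.

Lemma dist2_sym p q : dist2 p q = dist2 q p.
Proof. rewrite !dist2_euc. apply distance_symm. Qed.

Lemma dist2_triangle p q r : dist2 p r <= dist2 p q + dist2 q r.
Proof. rewrite !dist2_euc. apply triangle. Qed.

Lemma dist2_refl p : dist2 p p = 0.
Proof. rewrite dist2_euc. apply distance_refl. Qed.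

Lemma dist2_pos p q : 0 <= dist2 p q.
Proof. apply sqrt_pos. Qed.

Lemma dist2_sq p q :
  dist2 p q * dist2 p q = (fst p - fst q) ^ 2 + (snd p - snd q) ^ 2.
Proof. apply sqrt_sqrt. apply Rplus_le_le_0_compat; apply pow2_ge_0. Qed.

Lemma dist2_fst p q : Rabs (fst p - fst q) <= dist2 p q.
Proof.
  rewrite <- sqrt_Rsqr_abs. apply sqrt_le_1_alt.
  generalize (pow2_ge_0 (snd p - snd q)). unfold Rsqr. lra.
Qed.

Lemma dist2_snd p q : Rabs (snd p - snd q) <= dist2 p q.
Proof.
  rewrite <- sqrt_Rsqr_abs. apply sqrt_le_1_alt.
  generalize (pow2_ge_0 (fst p - fst q)). unfold Rsqr. lra.
Qed.

Lemma dist2_le_sum p q :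
  dist2 p q <= Rabs (fst p - fst q) + Rabs (snd p - snd q).
Proof.
  assert (Ha := Rabs_pos (fst p - fst q)).
  assert (Hb := Rabs_pos (snd p - snd q)).
  rewrite <- (sqrt_square (_ + _)) by lra.
  apply sqrt_le_1_alt.
  rewrite <- (pow2_abs (fst p - fst q)), <- (pow2_abs (snd p - snd q)). nra.
Qed.

Lemma dist2_eq0 p q : dist2 p q <= 0 -> p = q.
Proof.
  intros H. assert (Ha := dist2_fst p q). assert (Hb := dist2_snd p q).
  assert (Ha' := Rabs_pos (fst p - fst q)).
  assert (Hb' := Rabs_pos (snd p - snd q)).
  destruct p as [a b], q as [c d]; simpl in *.
  f_equal; apply Rminus_diag_uniq; apply NNPP; intros N; apply Rabs_no_R0 in N; lra.
Qed.

Lemma dist2_neq p q : p <> q -> 0 < dist2 p q.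
Proof.
  intros H. apply Rnot_le_lt. intros H'. apply H, dist2_eq0, H'.
Qed.

Lemma inv_succ_pos n : 0 < / (INR n + 1).
Proof. apply Rinv_0_lt_compat. generalize (pos_INR n); lra. Qed.

Lemma exists_inv_succ_lt e : 0 < e -> exists n, / (INR n + 1) < e.
Proof.
  intros He. destruct (archimed_cor1 e He) as [n [H1 H2]]. exists n.
  apply Rlt_trans with (/ INR n); [|exact H1].
  apply Rinv_lt_contravar; [|lra].
  apply lt_0_INR in H2. nra.
Qed.

(** * Countable sets *)

Lemma countable_subset (A B : pt -> Prop) :
  (forall p, A p -> B p) -> countable_set B -> countable_set A.
Proof. intros H [f Hf]. exists f. auto. Qed.

Lemma countable_Union (F : nat -> pt -> Prop) :
  (forall n, countable_set (F n)) -> countable_set (fun p => exists n, F n p).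
Proof.
  intros H.
  destruct (choice (fun n f => forall x y, F n x -> F n y -> f x = f y -> x = y) H)
    as [g Hg].
  destruct (choice (fun p n => (exists m, F m p) -> F n p)) as [i Hi].
  { intros p. destruct (classic (exists m, F m p)) as [[m Hm]|N].
    - exists m; auto.
    - exists O; tauto. }
  exists (fun p => to_nat (i p, g (i p) p)).
  intros x y Hx Hy E. apply to_nat_inj in E. injection E as E1 E2.
  apply (Hg (i x)); auto.
  - rewrite E1; auto.
  - rewrite E2, E1; auto.
Qed.

Lemma countable_union (A B : pt -> Prop) :
  countable_set A -> countable_set B -> countable_set (fun p => A p \/ B p).
Proof.
  intros HA HB.
  apply countable_subset
    with (fun p => exists n, (match n with O => A | _ => B end) p).
  - intros p [H|H]; [exists O|exists 1%nat]; exact H.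
  - apply countable_Union. intros [|n]; assumption.
Qed.

Lemma countable_singleton a : countable_set (fun p => p = a).
Proof. exists (fun _ => O). intros; congruence. Qed.

Lemma uncountable_nonempty A : uncountable_set A -> exists p, A p.
Proof.
  intros H. apply NNPP. intros N. apply H. exists (fun _ => O).
  intros x y Hx. exfalso. eauto.
Qed.

Lemma uncountable_Union (A : pt -> Prop) (F : nat -> pt -> Prop) :
  uncountable_set A -> (forall p, A p -> exists n, F n p) ->
  exists n, uncountable_set (F n).
Proof.
  intros H HF. apply NNPP. intros N. apply H.
  apply (countable_subset _ _ HF), countable_Union.
  intros n. apply NNPP. intros N'. apply N. exists n. exact N'.
Qed.

(** * A countable base of the plane *)

Definition zval (k : nat) : R := let (a, b) := of_nat k in INR a - INR b.

Lemma zval_onto z : exists k, zval k = IZR z.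
Proof.
  exists (to_nat (Z.to_nat z, Z.to_nat (- z))).
  unfold zval. rewrite cancel_of_to, !INR_IZR_INZ, <- minus_IZR.
  f_equal. lia.
Qed.

(** Open squares around grid points of mesh [1 / (INR n + 1)]. The half-side is twice the mesh, so
    the squares of each scale cover the plane. *)
Definition box (i : nat) (p : pt) : Prop :=
  let (n, c) := of_nat i in let (a, b) := of_nat c in
  Rabs (fst p - zval a / (INR n + 1)) < 2 / (INR n + 1) /\
  Rabs (snd p - zval b / (INR n + 1)) < 2 / (INR n + 1).

Lemma grid_approx n x :
  exists a, Rabs (x - zval a / (INR n + 1)) < 2 / (INR n + 1).
Proof.
  assert (Hn := pos_INR n).
  destruct (zval_onto (up (x * (INR n + 1)))) as [a Ha]. exists a. rewrite Ha.
  destruct (archimed (x * (INR n + 1))) as [H1 H2].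
  assert (H3 := inv_succ_pos n). unfold Rdiv.
  set (u := IZR (up (x * (INR n + 1)))) in *.
  replace (x - u * / (INR n + 1))
    with ((x * (INR n + 1) - u) * / (INR n + 1)) by (field; lra).
  rewrite Rabs_mult, (Rabs_pos_eq (/ _)) by lra.
  apply Rmult_lt_compat_r; [lra|].
  rewrite Rabs_minus_sym, Rabs_pos_eq by lra. lra.
Qed.

Lemma box_basis p e :
  0 < e -> exists i, box i p /\ forall q, box i q -> dist2 p q < e.
Proof.
  (* In each coordinate both points lie within [e / 4] of the centre, so they differ by less than
     [e / 2]. *)
  intros He. destruct (exists_inv_succ_lt (e / 8)) as [n Hn]; [lra|].
  destruct (grid_approx n (fst p)) as [a Ha].
  destruct (grid_approx n (snd p)) as [b Hb].
  exists (to_nat (n, to_nat (a, b))). unfold box. rewrite !cancel_of_to.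
  split; [tauto|]. intros q [Ha' Hb'].
  apply Rle_lt_trans with (1 := dist2_le_sum p q).
  apply Rabs_def2 in Ha, Hb, Ha', Hb'. unfold Rdiv in *.
  assert (Rabs (fst p - fst q) < e / 2) by (apply Rabs_def1; lra).
  assert (Rabs (snd p - snd q) < e / 2) by (apply Rabs_def1; lra).
  lra.
Qed.

(** * Condensation points *)

(** By the countable base, only countably many points of [A] have a neighbourhood meeting [A] in a
    countable set; the others are condensation points. *)
Lemma exists_two_condensation_points A :
  uncountable_set A ->
  exists p q, p <> q /\
    (forall e, 0 < e -> uncountable_set (fun x => A x /\ dist2 p x < e)) /\
    (forall e, 0 < e -> uncountable_set (fun x => A x /\ dist2 q x < e)).
Proof.
  intros HA.
  set (D p := exists e, 0 < e /\ countable_set (fun x => A x /\ dist2 p x < e)).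
  assert (HD : countable_set (fun p => A p /\ D p)).
  { apply countable_subset with
      (fun p => exists i, box i p /\ A p /\ countable_set (fun x => box i x /\ A x)).
    - intros p [Hp [e [He Hc]]]. destruct (box_basis p e He) as [i [Hi1 Hi2]].
      exists i. repeat split; auto.
      apply countable_subset with (2 := Hc). intros x [H1 H2]; auto.
    - apply countable_Union. intros i.
      destruct (classic (countable_set (fun x => box i x /\ A x))) as [H|H].
      + apply countable_subset with (2 := H). tauto.
      + exists (fun _ => O). tauto. }
  assert (Hcond : forall x, ~ D x -> forall e, 0 < e ->
      uncountable_set (fun y => A y /\ dist2 x y < e)).
  { intros x Hx e He H. apply Hx. exists e. auto. }
  assert (Hu : uncountable_set (fun p => A p /\ ~ D p)).
  { intros H. apply HA.
    apply countable_subset with (2 := countable_union _ _ HD H).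
    intros p Hp. destruct (classic (D p)); tauto. }
  destruct (uncountable_nonempty _ Hu) as [p [Hp Hp']].
  destruct (classic (exists q, p <> q /\ ~ D q)) as [[q [Hq Hq']]|N].
  - exists p, q. auto.
  - exfalso. apply Hu. apply countable_subset with (2 := countable_singleton p).
    intros q [Hq Hq']. apply NNPP. intros E. apply N. exists q. auto.
Qed.

(** * Analytic sets *)

Definition agree (n : nat) (z w : nat -> nat) : Prop :=
  forall k, (k < n)%nat -> z k = w k.

(** Closedness in the product of the plane and Baire space, with cylinders as basic neighbourhoods
    of [z]. *)
Definition closed_rel (G : pt -> (nat -> nat) -> Prop) : Prop :=
  forall p z, ~ G p z -> exists e n, 0 < e /\
    forall q w, dist2 p q < e -> agree n z w -> ~ G q w.

Definition proj (G : pt -> (nat -> nat) -> Prop) (p : pt) : Prop := exists z, G p z.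

Definition analytic (A : pt -> Prop) : Prop :=
  exists G, closed_rel G /\ forall p, A p <-> proj G p.

Lemma analytic_iff (A B : pt -> Prop) :
  (forall p, A p <-> B p) -> analytic A -> analytic B.
Proof.
  intros H [G [HG HA]]. exists G. split; [exact HG|].
  intros p. rewrite <- H. apply HA.
Qed.

Lemma closed_analytic (A : pt -> Prop) : open2 (fun p => ~ A p) -> analytic A.
Proof.
  intros H. exists (fun p _ => A p). split.
  - intros p z Hp. destruct (H p Hp) as [e [He Hq]]. exists e, O. auto.
  - intros p. split; [|intros [z Hz]; exact Hz].
    intros Hp. exists (fun _ => O). exact Hp.
Qed.

Lemma analytic_inter_closed (A C : pt -> Prop) :
  analytic A -> open2 (fun p => ~ C p) -> analytic (fun p => A p /\ C p).
Proof.
  intros [G [HG HA]] HC. exists (fun p z => G p z /\ C p). split.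
  - intros p z N. apply not_and_or in N as [N|N].
    + destruct (HG p z N) as [e [n [He H]]]. exists e, n. split; [exact He|].
      intros q w Hq Hw [H1 _]. exact (H q w Hq Hw H1).
    + destruct (HC p N) as [e [He H]]. exists e, O. split; [exact He|].
      intros q w Hq _ [_ H2]. exact (H q Hq H2).
  - intros p. rewrite HA. unfold proj. firstorder.
Qed.

(** The entry [z O] names a set of the family containing the point, and the tail of [z] is the
    witness for that set. *)
Lemma analytic_Union (F : nat -> pt -> Prop) :
  (forall n, analytic (F n)) -> analytic (fun p => exists n, F n p).
Proof.
  intros H. destruct (choice _ H) as [G HG].
  exists (fun p z => G (z O) p (fun k => z (S k))). split.
  - intros p z N. destruct (proj1 (HG (z O)) _ _ N) as [e [n [He Hq]]].
    exists e, (S n). split; [exact He|]. intros q w Hd Hw.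
    rewrite <- (Hw O) by lia. apply Hq; [exact Hd|].
    intros k Hk. apply Hw. lia.
  - intros p. split.
    + intros [n Hn]. apply (proj2 (HG n)) in Hn as [z Hz].
      exists (fun k => match k with O => n | S j => z j end). exact Hz.
    + intros [z Hz]. exists (z O). apply (proj2 (HG (z O))). eexists; exact Hz.
Qed.

Lemma bounded_on_initial_segment (f : nat -> nat) n :
  exists M, forall k, (k < n)%nat -> (f k < M)%nat.
Proof.
  induction n as [|n [M HM]]; [exists O; lia|].
  exists (Nat.max M (S (f n))). intros k Hk.
  destruct (Nat.eq_dec k n) as [->|]; [lia|].
  specialize (HM k). lia.
Qed.

(** Pairing packs one witness for each [F n] into a single sequence. *)
Lemma analytic_Inter (F : nat -> pt -> Prop) :
  (forall n, analytic (F n)) -> analytic (fun p => forall n, F n p).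
Proof.
  intros H. destruct (choice _ H) as [G HG].
  exists (fun p z => forall n, G n p (fun k => z (to_nat (n, k)))). split.
  - intros p z N. apply not_all_ex_not in N as [n N].
    destruct (proj1 (HG n) _ _ N) as [e [m [He Hq]]].
    (* Agreement below [M] fixes the first [m] entries of row [n]. *)
    destruct (bounded_on_initial_segment (fun k => to_nat (n, k)) m) as [M HM].
    exists e, M. split; [exact He|]. intros q w Hd Hw HN.
    apply (Hq q (fun k => w (to_nat (n, k))) Hd); [|apply HN].
    intros k Hk. apply Hw, HM, Hk.
  - intros p. split.
    + intros Hp. assert (Hz : forall n, exists z, G n p z).
      { intros n. apply (proj2 (HG n)), Hp. }
      apply choice in Hz as [f Hf].
      exists (fun j => let (n, k) := of_nat j in f n k). intros n.
      replace (fun k => _) with (f n); [apply Hf|].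
      apply functional_extensionality. intros k. now rewrite cancel_of_to.
    + intros [z Hz] n. apply (proj2 (HG n)). eexists; apply Hz.
Qed.

(* An open set is the union over [m] of the closed sets of points at distance at
   least [1 / (m + 1)] from its complement. *)
Lemma open_analytic (U : pt -> Prop) : open2 U -> analytic U.
Proof.
  intros HU.
  apply analytic_iff with
    (fun p => exists m, forall q, ~ U q -> / (INR m + 1) <= dist2 p q).
  - intros p. split.
    + intros [m Hm]. apply NNPP. intros N. specialize (Hm p N).
      rewrite dist2_refl in Hm. generalize (inv_succ_pos m). lra.
    + intros Hp. destruct (HU p Hp) as [e [He Hq]].
      destruct (exists_inv_succ_lt e He) as [m Hm]. exists m.
      intros q Hn. apply Rnot_lt_le. intros Hd. apply Hn, Hq. lra.
  - apply analytic_Union. intros m. apply closed_analytic.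
    intros p N. apply not_all_ex_not in N as [q N].
    apply imply_to_and in N as [N1 N2]. apply Rnot_le_lt in N2.
    exists (/ (INR m + 1) - dist2 p q). split; [lra|].
    intros x Hx Hm. specialize (Hm q N1).
    assert (Ht := dist2_triangle x p q). rewrite (dist2_sym x p) in Ht. lra.
Qed.

(** The sets that are analytic together with their complements form a sigma-algebra containing the
    open sets. *)
Theorem borel_analytic (Z : pt -> Prop) : borel2 Z -> analytic Z.
Proof.
  intros HZ.
  refine (proj1 (HZ (fun A => analytic A /\ analytic (fun p => ~ A p)) _ _)).
  - split; [|split].
    + split; apply closed_analytic; intros p Hp.
      * tauto.
      * exists 1. split; [lra|]. tauto.
    + intros A [H1 H2]. split; [exact H2|].
      revert H1. apply analytic_iff. intros p. split; [tauto|apply NNPP].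
    + intros F HF. split; [apply analytic_Union; intros n; apply HF|].
      apply analytic_iff with (fun p => forall n, ~ F n p).
      * intros p. split; [firstorder|]. intros N n Hn. apply N. exists n. exact Hn.
      * apply analytic_Inter. intros n. apply HF.
  - intros U HU. split; [apply open_analytic, HU|].
    apply closed_analytic. intros p Hp. apply NNPP in Hp.
    destruct (HU p Hp) as [e [He Hq]]. exists e. split; [exact He|].
    intros q Hd. specialize (Hq q Hd). tauto.
Qed.

(** * Coding analytic sets by points of Cantor space *)

Fixpoint prefix_code (z : nat -> nat) (n : nat) : nat :=
  match n with
  | O => O
  | S m => S (to_nat (prefix_code z m, z m))
  end.

Lemma prefix_code_inj n m z w :
  prefix_code z n = prefix_code w m -> n = m /\ agree n z w.
Proof.
  revert m. induction n as [|n IH]; intros [|m] E; try discriminate E.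
  - split; [reflexivity|]. intros k Hk. lia.
  - cbn [prefix_code] in E. apply Nat.succ_inj, to_nat_inj in E. injection E as E1 E2.
    apply IH in E1 as [-> H]. split; [reflexivity|]. intros k Hk.
    destruct (Nat.eq_dec k m) as [->|]; [exact E2|]. apply H. lia.
Qed.

(* [c] marks the basic open boxes of [pt x nat^nat] missing the closed set whose
   projection is coded. *)
Definition coded (c : nat -> bool) (p : pt) : Prop :=
  exists z, forall i n, box i p -> c (to_nat (i, prefix_code z n)) = false.

(** The complement of the closed [G] is a union of basic boxes, so a pair lies in [G] exactly when
    none of its basic boxes is marked. *)
Lemma analytic_coded (A : pt -> Prop) :
  analytic A -> exists c, forall p, A p <-> coded c p.
Proof.
  intros [G [HG HA]].
  set (Q k := exists i z n, k = to_nat (i, prefix_code z n) /\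
                forall q w, box i q -> agree n z w -> ~ G q w).
  exists (fun k => if excluded_middle_informative (Q k) then true else false).
  intros p. rewrite HA. split; intros [z Hz]; exists z.
  - intros i n Hi. destruct (excluded_middle_informative _) as [[j [w [m [E H]]]]|];
      [exfalso|reflexivity].
    apply to_nat_inj in E. injection E as -> E. symmetry in E.
    apply prefix_code_inj in E as [-> E]. exact (H p z Hi E Hz).
  - apply NNPP. intros N. destruct (HG p z N) as [e [n [He H]]].
    destruct (box_basis p e He) as [i [Hi Hb]]. specialize (Hz i n Hi).
    destruct (excluded_middle_informative _) as [|NQ]; [discriminate|].
    apply NQ. exists i, z, n. split; [reflexivity|]. auto.
Qed.

(** * The perfect set property of analytic sets *)

(** One branching of a Cantor scheme. Small balls around two condensation points of the projection
    give the halves, and a pigeonhole over the countably many prefixes of length [n] fixes the first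
    [n] entries of the witnesses. *)
Lemma split_uncountable (W : pt -> (nat -> nat) -> Prop) (n : nat) :
  uncountable_set (proj W) ->
  exists V : bool -> pt -> (nat -> nat) -> Prop,
    (forall b, uncountable_set (proj (V b))) /\
    (forall b p z, V b p z -> W p z) /\
    (forall b p z q w, V b p z -> V b q w ->
       dist2 p q <= / (INR n + 1) /\ agree n z w) /\
    exists d, 0 < d /\ forall b b' p z q w,
      b <> b' -> V b p z -> V b' q w -> d <= dist2 p q.
Proof.
  intros HW.
  destruct (exists_two_condensation_points _ HW) as [p0 [p1 [Hne [H0 H1]]]].
  apply dist2_neq in Hne.
  (* The first bound leaves a gap of a third of [dist2 p0 p1] between the balls; the second bounds
     their diameters by [/ (INR n + 1)]. *)
  set (e := Rmin (dist2 p0 p1 / 3) (/ (INR n + 1) / 2)).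
  assert (Hn := inv_succ_pos n).
  assert (He : 0 < e) by (apply Rmin_glb_lt; lra).
  assert (He1 : e <= dist2 p0 p1 / 3) by apply Rmin_l.
  assert (He2 : e <= / (INR n + 1) / 2) by apply Rmin_r.
  set (a (b : bool) := if b then p1 else p0).
  assert (Hm : forall b, exists m,
    uncountable_set (fun x => exists z, W x z /\ dist2 (a b) x < e /\ prefix_code z n = m)).
  { intros b. apply uncountable_Union with
      (A := fun x => proj W x /\ dist2 (a b) x < e).
    - destruct b; simpl; auto.
    - intros x [[z Hz] Hd]. exists (prefix_code z n), z. auto. }
  apply choice in Hm as [m Hm].
  exists (fun b x z => W x z /\ dist2 (a b) x < e /\ prefix_code z n = m b).
  split; [exact Hm|]. split; [tauto|]. split.
  - intros b p z q w [_ [Hp Ez]] [_ [Hq Ew]]. split.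
    + assert (Ht := dist2_triangle p (a b) q). rewrite (dist2_sym p (a b)) in Ht. lra.
    + rewrite <- Ew in Ez. apply prefix_code_inj in Ez. tauto.
  - exists (dist2 p0 p1 / 3). split; [lra|].
    intros b b' p z q w Hb [_ [Hp _]] [_ [Hq _]].
    assert (Ht1 := dist2_triangle (a b) p (a b')).
    assert (Ht2 := dist2_triangle p q (a b')). rewrite (dist2_sym q (a b')) in Ht2.
    assert (Ha : dist2 (a b) (a b') = dist2 p0 p1).
    { destruct b, b'; simpl; try congruence. apply dist2_sym. }
    lra.
Qed.

Lemma dist2_complete (u : nat -> pt) :
  (forall e, 0 < e -> exists N, forall n m,
     (N <= n)%nat -> (N <= m)%nat -> dist2 (u n) (u m) < e) ->
  exists l, forall e, 0 < e -> exists N, forall n, (N <= n)%nat -> dist2 (u n) l < e.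
Proof.
  intros H.
  destruct (R_complete (fun n => fst (u n))) as [x Hx].
  { intros e He. destruct (H e He) as [N HN]. exists N. intros n m Hn Hm.
    apply Rle_lt_trans with (1 := dist2_fst _ _). auto. }
  destruct (R_complete (fun n => snd (u n))) as [y Hy].
  { intros e He. destruct (H e He) as [N HN]. exists N. intros n m Hn Hm.
    apply Rle_lt_trans with (1 := dist2_snd _ _). auto. }
  exists (x, y). intros e He.
  destruct (Hx (e / 2)) as [N1 HN1]; [lra|].
  destruct (Hy (e / 2)) as [N2 HN2]; [lra|].
  exists (Nat.max N1 N2). intros n Hn.
  apply Rle_lt_trans with (1 := dist2_le_sum _ _).
  assert (H1 := HN1 n ltac:(lia)). assert (H2 := HN2 n ltac:(lia)).
  unfold Rdist in H1, H2. simpl. lra.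
Qed.

(** Along each branch of a Cantor scheme for [G], points and witnesses converge, and closedness of
    [G] puts the limit in [A]. Branches that split enter separated sets, so [h] is injective. *)
Theorem uncountable_analytic_perfect (A : pt -> Prop) :
  analytic A -> uncountable_set A ->
  exists h : (nat -> bool) -> pt,
    (forall t, A (h t)) /\ forall t t', h t = h t' -> t = t'.
Proof.
  intros [G [HG HA]] Hunc.
  assert (HGu : uncountable_set (proj G)).
  { intros H. apply Hunc. apply countable_subset with (2 := H). apply HA. }
  assert (Hsplit : forall Wn : (pt -> (nat -> nat) -> Prop) * nat, exists V,
    uncountable_set (proj (fst Wn)) ->
    (forall b, uncountable_set (proj (V b))) /\
    (forall b p z, V b p z -> fst Wn p z) /\
    (forall b p z q w, V b p z -> V b q w ->
       dist2 p q <= / (INR (snd Wn) + 1) /\ agree (snd Wn) z w) /\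
    exists d, 0 < d /\ forall (b b' : bool) p z q w,
      b <> b' -> V b p z -> V b' q w -> d <= dist2 p q).
  { intros [W n]. destruct (classic (uncountable_set (proj W))) as [H|H].
    - destruct (split_uncountable W n H) as [V HV]. exists V. auto.
    (* A dummy value that makes the splitting total; [Su] shows that no node of the scheme falls in
       this case. *)
    - exists (fun _ => W). tauto. }
  apply choice in Hsplit as [sp Hsp].
  set (scheme t := fix scheme n := match n with
                   | O => G | S m => sp (scheme m, m) (t m) end).
  assert (Su : forall t n, uncountable_set (proj (scheme t n))).
  { intros t n. induction n as [|n IH]; [exact HGu|].
    apply (proj1 (Hsp (scheme t n, n) IH)). }
  assert (Sn : forall t n m p z, (n <= m)%nat -> scheme t m p z -> scheme t n p z).
  { intros t n m p z Hnm. induction Hnm as [|m Hnm IH]; [auto|].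
    intros H. apply IH. apply (Hsp (scheme t m, m) (Su t m)) in H. exact H. }
  assert (Sd : forall t n p z q w, scheme t (S n) p z -> scheme t (S n) q w ->
     dist2 p q <= / (INR n + 1) /\ agree n z w).
  { intros t n p z q w. apply (Hsp (scheme t n, n) (Su t n)). }
  assert (Spts : forall tn : (nat -> bool) * nat, exists pz,
     scheme (fst tn) (snd tn) (fst pz) (snd pz)).
  { intros [t n]. destruct (uncountable_nonempty _ (Su t n)) as [p [z Hz]].
    exists (p, z). exact Hz. }
  apply choice in Spts as [pz Hpz].
  set (u t n := fst (pz (t, n))). set (zz t n := snd (pz (t, n))).
  assert (Hin : forall t n m, (n <= m)%nat -> scheme t n (u t m) (zz t m)).
  { intros t n m Hnm. apply (Sn t n m _ _ Hnm). apply (Hpz (t, m)). }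
  assert (Hlim : forall t, exists l, forall e, 0 < e -> exists N, forall n,
     (N <= n)%nat -> dist2 (u t n) l < e).
  { intros t. apply dist2_complete. intros e He.
    destruct (exists_inv_succ_lt e He) as [N HN]. exists (S N). intros n m Hn Hm.
    apply Rle_lt_trans with (2 := HN).
    apply (Sd t N _ (zz t n) _ (zz t m)); apply Hin; assumption. }
  apply choice in Hlim as [h Hh]. exists h. split.
  (* Witnesses in the node of level [S (S k)] agree on their first [S k] entries, so entry [k] is
     constant from that level on. *)
  - intros t. apply HA. set (z k := zz t (S (S k)) k). exists z. apply NNPP. intros N.
    destruct (HG _ _ N) as [e [m [He Hno]]].
    destruct (Hh t e He) as [N1 HN1].
    set (n := Nat.max N1 (S m)).
    apply (Hno (u t n) (zz t n)).
    + rewrite dist2_sym. apply HN1. lia.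
    + intros k Hk. unfold z.
      refine (proj2 (Sd t (S k) (u t (S (S k))) _ (u t n) _ _ _) k _);
        [apply Hin | apply Hin | ]; lia.
    + apply (Hin t O). lia.
  - intros t t' E. apply functional_extensionality. intros n.
    (* At a first disagreement [n] both branches share the node of level [n] and then enter children
       at distance at least [d], while their approximations come within [d / 2] of the common
       limit. *)
    induction n as [n IH] using lt_wf_ind. apply NNPP. intros Hne.
    assert (Es : forall m, (m <= n)%nat -> scheme t m = scheme t' m).
    { induction m as [|m IHm]; intros Hm; [reflexivity|].
      simpl. rewrite IHm, IH by lia. reflexivity. }
    destruct (proj2 (proj2 (proj2 (Hsp (scheme t n, n) (Su t n))))) as [d [Hd Hsep]].
    destruct (Hh t (d / 2)) as [N1 HN1]; [lra|].
    destruct (Hh t' (d / 2)) as [N2 HN2]; [lra|].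
    set (m := Nat.max (S n) (Nat.max N1 N2)).
    assert (H1 := HN1 m ltac:(lia)). assert (H2 := HN2 m ltac:(lia)).
    assert (Ht := dist2_triangle (u t m) (h t) (u t' m)).
    rewrite (dist2_sym (h t)), E in Ht. rewrite E in H1.
    assert (Hs : d <= dist2 (u t m) (u t' m)).
    { apply (Hsep _ _ _ (zz t m) _ (zz t' m) Hne).
      - apply (Hin t (S n)). lia.
      - rewrite (Es n) by lia. apply (Hin t' (S n)). lia. }
    lra.
Qed.

(** * Sets of size less than the continuum *)

(** Absence of a surjection onto Cantor space; under choice this means cardinality less than the
    continuum. *)
Definition below_continuum (S : Type) : Prop :=
  forall f : S -> nat -> bool, exists c, forall s, f s <> c.

(* König's argument, with [2^nat] identified with [(2^nat)^nat]. *)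
Lemma below_continuum_mul_nat (S : Type) :
  below_continuum S ->
  forall g : S -> nat -> nat -> bool, exists c, forall s n, g s n <> c.
Proof.
  intros HS g.
  assert (Hc : forall n, exists c, forall s, (fun k => g s n (to_nat (n, k))) <> c).
  { intros n. apply (HS (fun s k => g s n (to_nat (n, k)))). }
  apply choice in Hc as [y Hy].
  exists (fun j => let (n, k) := of_nat j in y n k). intros s n E.
  apply (Hy n s), functional_extensionality. intros k.
  rewrite E, cancel_of_to. reflexivity.
Qed.

(** On an injective image of Cantor space inside [P], each [F s] has only countably many points. The
    bad parameters are thus indexed by [S] times [nat] and cannot exhaust [nat -> bool]. *)
Lemma uncountable_analytic_avoid (S : Type) (P : pt -> Prop) (F : S -> pt -> Prop) :
  below_continuum S -> analytic P -> uncountable_set P ->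
  (forall s, countable_set (F s)) ->
  exists p, P p /\ forall s, ~ F s p.
Proof.
  intros HS HP Hu HF.
  destruct (uncountable_analytic_perfect P HP Hu) as [h [Hh1 Hh2]].
  apply choice in HF as [f Hf].
  set (Q s n c := F s (h c) /\ f s (h c) = n).
  (* Here [epsilon] returns the only parameter whose point lies in [F s] with number [n], or an
     arbitrary value if there is none. *)
  destruct (below_continuum_mul_nat S HS
    (fun s n => epsilon (inhabits (fun _ => true)) (Q s n))) as [c Hc].
  exists (h c). split; [apply Hh1|]. intros s Hs.
  apply (Hc s (f s (h c))), Hh2.
  destruct (epsilon_spec (inhabits (fun _ => true)) (Q s (f s (h c)))) as [H1 H2].
  { exists c. split; [exact Hs|reflexivity]. }
  apply (Hf s); assumption.
Qed.

(** * Unit circles and the choice of one pair of points *)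

Lemma circle_inter_countable a b :
  a <> b -> countable_set (fun p => dist2 a p = 1 /\ dist2 b p = 1).
Proof.
  intros Hab.
  (* The two intersection points are told apart by the side of line [ab]. *)
  set (s (p : pt) := (fst b - fst a) * (snd p - snd a) - (snd b - snd a) * (fst p - fst a)).
  exists (fun p => if Rle_dec 0 (s p) then 0%nat else 1%nat).
  intros p q [Hp1 Hp2] [Hq1 Hq2] E.
  assert (Kp1 := dist2_sq a p). assert (Kp2 := dist2_sq b p).
  assert (Kq1 := dist2_sq a q). assert (Kq2 := dist2_sq b q).
  assert (Kab := dist2_sq a b). apply dist2_neq in Hab.
  rewrite Hp1 in Kp1. rewrite Hp2 in Kp2. rewrite Hq1 in Kq1. rewrite Hq2 in Kq2.
  set (D := dist2 a b * dist2 a b) in *.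
  assert (HD : 0 < D) by (apply Rmult_lt_0_compat; assumption).
  (* Coordinates along and across [ab], scaled by its length, are [t] and [s]. The circle equations
     determine [t p], and then [s p] up to sign. *)
  set (t (p : pt) := (fst b - fst a) * (fst p - fst a) + (snd b - snd a) * (snd p - snd a)).
  assert (Hu : t p = t q) by (unfold t; nra).
  assert (Hp : s p * s p = D - t p * t p).
  { replace D with (D * (1 * 1)) by ring. rewrite Kp1 at 1. rewrite Kab. unfold s, t. ring. }
  assert (Hq : s q * s q = D - t q * t q).
  { replace D with (D * (1 * 1)) by ring. rewrite Kq1 at 1. rewrite Kab. unfold s, t. ring. }
  assert (Hs : s p = s q).
  { destruct (Rle_dec 0 (s p)), (Rle_dec 0 (s q)); try discriminate E; nra. }
  apply dist2_eq0.
  assert (Hpq : D * (dist2 p q * dist2 p q) = (t p - t q) ^ 2 + (s p - s q) ^ 2).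
  { rewrite dist2_sq, Kab. unfold s, t. ring. }
  rewrite Hu, Hs in Hpq.
  assert (Hpos := dist2_pos p q).
  apply Rnot_lt_le. intros Hlt.
  assert (0 < D * (dist2 p q * dist2 p q)) by (repeat apply Rmult_lt_0_compat; assumption).
  lra.
Qed.

Lemma circle_closed a r : open2 (fun p => ~ dist2 a p = r).
Proof.
  intros p Hp. exists (Rabs (dist2 a p - r)). split.
  - apply Rabs_pos_lt. lra.
  - intros q Hq E.
    assert (H1 := dist2_triangle a p q). assert (H2 := dist2_triangle a q p).
    rewrite (dist2_sym q p) in H2.
    revert Hq. unfold Rabs. destruct (Rcase_abs _); lra.
Qed.

(* Two distinct unit circles share at most two points.  So if [P] meets some circle
   around [X s] in an uncountable set, it suffices to choose [x] on that circle,
   where every other circle forbids two points; otherwise every circle forbids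
   countably many points of [P].  Thus no count of pairs of indices is needed. *)
Lemma avoid_unit_triangles (S : Type) (P : pt -> Prop) (X Y : S -> pt) :
  below_continuum S -> analytic P -> uncountable_set P ->
  exists x, P x /\ (forall s, x <> Y s) /\
    forall s t, X s <> X t -> ~ (dist2 (X s) x = 1 /\ dist2 (X t) x = 1).
Proof.
  intros HS HP Hu.
  destruct (classic (exists s, uncountable_set (fun p => P p /\ dist2 (X s) p = 1)))
    as [[s0 Hs0]|N].
  - destruct (uncountable_analytic_avoid S (fun p => P p /\ dist2 (X s0) p = 1)
      (fun t p => p = Y t \/ (X s0 <> X t /\ dist2 (X s0) p = 1 /\ dist2 (X t) p = 1)))
      as [x [[Hx1 Hx2] Hx3]]; auto.
    + apply analytic_inter_closed; [exact HP|apply circle_closed].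
    + intros t. apply countable_union; [apply countable_singleton|].
      destruct (classic (X s0 = X t)) as [E|E].
      * exists (fun _ => O). tauto.
      * apply countable_subset with (2 := circle_inter_countable _ _ E). tauto.
    + exists x. split; [exact Hx1|]. split.
      * intros s E. apply (Hx3 s). auto.
      * intros s t Hst [H1 H2].
        (* Since [X s] and [X t] differ, one of them differs from [X s0], and [x] was chosen off the
           unit circle around that one. *)
        destruct (classic (X s0 = X s)) as [E|E].
        -- apply (Hx3 t). right. rewrite E. rewrite E in Hx2. auto.
        -- apply (Hx3 s). auto.
  - destruct (uncountable_analytic_avoid S P
      (fun t p => p = Y t \/ (P p /\ dist2 (X t) p = 1))) as [x [Hx1 Hx2]]; auto.
    + intros t. apply countable_union; [apply countable_singleton|].
      apply NNPP. intros H. apply N. exists t. exact H.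
    + exists x. split; [exact Hx1|]. split.
      * intros s E. apply (Hx2 s). auto.
      * intros s t _ [H _]. apply (Hx2 s). auto.
Qed.

Lemma avoid_points (S : Type) (P : pt -> Prop) (X : S -> pt) (x : pt) :
  below_continuum S -> analytic P -> uncountable_set P ->
  exists y, P y /\ y <> x /\ forall s, y <> X s.
Proof.
  (* The point [x] is excluded through an index in [S], so an empty [S] is treated apart: there an
     uncountable [P] has a point other than [x]. *)
  intros HS HP Hu. destruct (classic (inhabited S)) as [[s0]|N].
  - destruct (uncountable_analytic_avoid S P (fun s p => p = X s \/ p = x))
      as [y [Hy1 Hy2]]; auto.
    + intros s. apply countable_union; apply countable_singleton.
    + exists y. split; [exact Hy1|]. split.
      * intros E. apply (Hy2 s0). auto.
      * intros s E. apply (Hy2 s). auto.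
  - apply NNPP. intros H. apply Hu.
    apply countable_subset with (2 := countable_singleton x).
    intros p Hp. apply NNPP. intros E. apply H. exists p. split; [exact Hp|].
    split; [exact E|]. intros s. exfalso. apply N. constructor. exact s.
Qed.

(** * Well-orders with small initial segments *)

Definition trichotomous {I : Type} (lt : I -> I -> Prop) : Prop :=
  forall i j, lt i j \/ i = j \/ lt j i.

(** Well-foundedness rules out cycles of length two and three, and trichotomy then leaves only
    [lt i k]. *)
Lemma wf_trichotomous_trans (I : Type) (lt : I -> I -> Prop) :
  well_founded lt -> trichotomous lt -> forall i j k, lt i j -> lt j k -> lt i k.
Proof.
  intros Hwf Ht.
  assert (Hcycle : forall i j k, lt i j -> lt j k -> ~ lt k i).
  { intros i. induction i as [i IH] using (well_founded_ind Hwf).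
    intros j k H1 H2 H3. exact (IH k H3 i j H3 H1 H2). }
  assert (Hcycle2 : forall i j, lt i j -> ~ lt j i).
  { intros i. induction i as [i IH] using (well_founded_ind Hwf).
    intros j H1 H2. exact (IH j H2 i H2 H1). }
  intros i j k H1 H2. destruct (Ht i k) as [H|[H|H]].
  - exact H.
  - subst. exfalso. eapply Hcycle2; eassumption.
  - exfalso. eapply Hcycle; eassumption.
Qed.

Lemma exists_well_order (T : Type) :
  exists lt : T -> T -> Prop, well_founded lt /\ trichotomous lt.
Proof.
  destruct (wochoice.well_ordering_principle
    (eqtype.Equality.Pack (eqtype.Equality.Class (boolp.gen_eqMixin T)))) as [R HR].
  assert (Hmin : forall P : T -> Prop, (exists x, P x) ->
    exists z, (P z /\ forall x, P x -> R z x = true) /\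
      forall z', P z' -> (forall x, P x -> R z' x = true) -> z = z').
  { intros P [x0 Hx0].
    set (A x := if excluded_middle_informative (P x) then true else false).
    assert (HA : forall x, A x = true <-> P x).
    { intros x. unfold A. destruct (excluded_middle_informative (P x));
        split; try discriminate; tauto. }
    destruct (HR A) as [z [[Hz1 Hz2] Hz3]].
    - exists x0. apply (proj2 (HA x0) Hx0).
    - exists z. split; [split|].
      + apply HA, Hz1.
      + intros x Hx. apply Hz2, (proj2 (HA x) Hx).
      + intros z' Hz' H. apply Hz3. split; [apply (proj2 (HA z') Hz')|].
        intros x Hx. apply H, HA, Hx. }
  (* The strict order is the negation of the reversed [R]; uniqueness of least elements, applied to
     a pair, gives trichotomy. *)
  exists (fun x y => R y x <> true). split.
  - intros x. apply NNPP. intros N.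
    destruct (Hmin (fun x => ~ Acc (fun x y => R y x <> true) x)) as [z [[Hz1 Hz2] _]].
    { exists x. exact N. }
    apply Hz1. constructor. intros y Hy. apply NNPP. intros Hy'.
    apply Hy, Hz2, Hy'.
  - intros x y.
    destruct (classic (R y x = true)) as [H1|H1]; [|auto].
    destruct (classic (R x y = true)) as [H2|H2]; [|auto].
    right. left.
    assert (Hr : forall v, R v v = true).
    { intros v. destruct (Hmin (fun w => w = v)) as [z [[-> Hz] _]]; eauto. }
    destruct (Hmin (fun w => w = x \/ w = y)) as [z [_ Hz]]; [eauto|].
    rewrite <- (Hz x), <- (Hz y); auto; intros w [->| ->]; auto.
Qed.

(** If some proper initial segment of a well-ordered [nat -> bool] surjects onto [nat -> bool], the
    least such segment is the index set and the surjection is [e]. Otherwise the whole order with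
    the identity works. *)
Lemma exists_initial_well_order :
  exists (I : Type) (lt : I -> I -> Prop) (e : I -> nat -> bool),
    well_founded lt /\ trichotomous lt /\
    (forall i, below_continuum {j | lt j i}) /\ forall c, exists i, e i = c.
Proof.
  destruct (exists_well_order (nat -> bool)) as [lt [Hwf Ht]].
  assert (Htr := wf_trichotomous_trans _ lt Hwf Ht).
  destruct (classic (forall x, below_continuum {y | lt y x})) as [H|H].
  { exists (nat -> bool), lt, (fun c => c).
    split; [exact Hwf|]. split; [exact Ht|]. split; [exact H|].
    intros c. exists c. reflexivity. }
  assert (Hmin : exists x, ~ below_continuum {y | lt y x} /\
            forall z, lt z x -> below_continuum {y | lt y z}).
  { apply NNPP. intros N. apply H. intros x.
    induction x as [x IH] using (well_founded_ind Hwf).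
    apply NNPP. intros Hx. apply N. exists x. auto. }
  destruct Hmin as [x [Hx Hlt]].
  apply not_all_ex_not in Hx as [e He].
  exists {y | lt y x}, (fun i j => lt (proj1_sig i) (proj1_sig j)), e.
  split; [|split; [|split]].
  - exact (wf_inverse_image _ _ lt (@proj1_sig _ _) Hwf).
  - intros [i Hi] [j Hj]. simpl. destruct (Ht i j) as [K|[K|K]]; auto.
    right. left. apply subset_eq_compat, K.
  - intros [i Hi] f. simpl in f.
    destruct (Hlt i Hi (fun s => f (exist _ (exist _ (proj1_sig s)
      (Htr _ _ _ (proj2_sig s) Hi)) (proj2_sig s)))) as [c Hc].
    exists c. intros [[y Hy] Hyi]. simpl in Hyi. specialize (Hc (exist _ y Hyi)).
    simpl in Hc. rewrite (proof_irrelevance _ Hy (Htr _ _ _ Hyi Hi)). exact Hc.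
  - intros c. apply NNPP. intros N. apply He. exists c. intros s E. apply N.
    exists s. exact E.
Qed.

(** * The transfinite recursion *)

Definition unit_triangle_free (B : pt -> Prop) : Prop :=
  forall p q r, B p -> B q -> B r ->
    ~ (dist2 p q = 1 /\ dist2 q r = 1 /\ dist2 p r = 1).

(** The first component of [v] enters the set under construction and the second stays out; [X] and
    [Y] list the earlier components of the two kinds. *)
Definition step_spec {S : Type} (P : pt -> Prop) (X Y : S -> pt) (v : pt * pt) : Prop :=
  (P (fst v) /\ (forall s, fst v <> Y s) /\
    forall s t, X s <> X t -> ~ (dist2 (X s) (fst v) = 1 /\ dist2 (X t) (fst v) = 1)) /\
  (P (snd v) /\ snd v <> fst v /\ forall s, snd v <> X s).

Lemma exists_bernstein_unit_triangle_free :
  exists B, bernstein B /\ unit_triangle_free B.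
Proof.
  destruct exists_initial_well_order as [I [lt [e [Hwf [Ht [Hs He]]]]]].
  assert (Htr := wf_trichotomous_trans _ lt Hwf Ht).
  set (spec i (prev : forall j, lt j i -> pt * pt) := step_spec (coded (e i))
    (fun s : {j | lt j i} => fst (prev (proj1_sig s) (proj2_sig s)))
    (fun s : {j | lt j i} => snd (prev (proj1_sig s) (proj2_sig s)))).
  (* If the specification cannot be met, the pair is arbitrary. The set built below takes points
     from [good] codes only, where [Hf] shows that it is met. *)
  set (next i prev := epsilon (inhabits ((0, 0), (0, 0))) (spec i prev)).
  set (f := Fix Hwf (fun _ => (pt * pt)%type) next).
  set (good i := analytic (coded (e i)) /\ uncountable_set (coded (e i))).
  assert (Hf : forall i, good i -> spec i (fun j _ => f j) (f i)).
  { intros i [Hi1 Hi2]. unfold f at 2. rewrite Fix_eq.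
    - apply epsilon_spec. unfold spec.
      destruct (avoid_unit_triangles {j | lt j i} (coded (e i))
        (fun s => fst (f (proj1_sig s))) (fun s => snd (f (proj1_sig s))))
        as [x Hx]; auto.
      destruct (avoid_points {j | lt j i} (coded (e i))
        (fun s => fst (f (proj1_sig s))) x) as [y Hy]; auto.
      exists (x, y). split; assumption.
    - intros j g g' Hg. f_equal.
      apply functional_extensionality_dep. intros k.
      apply functional_extensionality. apply Hg. }
  exists (fun p => exists i, good i /\ p = fst (f i)). split.
  - intros Z HZ HZu.
    assert (HZa := borel_analytic Z HZ).
    destruct (analytic_coded Z HZa) as [c Hc]. destruct (He c) as [i <-].
    assert (Hi : good i).
    { split.
      - exact (analytic_iff _ _ Hc HZa).
      - intros H. apply HZu. apply countable_subset with (2 := H). apply Hc. }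
    destruct (Hf i Hi) as [[Hx _] [Hy [Hyx Hy']]].
    split.
    + exists (fst (f i)). split; [apply Hc, Hx|]. exists i. auto.
    + exists (snd (f i)). split; [apply Hc, Hy|]. intros [j [Hj E]].
      (* An equality between the point kept out at [i] and the point put in at [j] is refuted at the
         later of the two stages. *)
      destruct (Ht i j) as [K|[<-|K]].
      * destruct (Hf j Hj) as [[_ [Hxy _]] _].
        apply (Hxy (exist _ i K)). symmetry. exact E.
      * exact (Hyx E).
      * exact (Hy' (exist _ j K) E).
  (* A unit triangle is refuted at its vertex of largest index; the other two vertices are distinct,
     being at distance 1. *)
  - assert (Hlast : forall i j k, good i -> lt j i -> lt k i ->
      dist2 (fst (f j)) (fst (f k)) = 1 ->
      ~ (dist2 (fst (f j)) (fst (f i)) = 1 /\ dist2 (fst (f k)) (fst (f i)) = 1)).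
    { intros i j k Hi Hj Hk Hjk.
      destruct (Hf i Hi) as [[_ [_ H]] _].
      apply (H (exist _ j Hj) (exist _ k Hk)). simpl. intros E.
      rewrite E, dist2_refl in Hjk. lra. }
    intros p q r [i [Hi ->]] [j [Hj ->]] [k [Hk ->]] [Hij [Hjk Hik]].
    assert (Hji := Hij). assert (Hkj := Hjk). assert (Hki := Hik).
    rewrite dist2_sym in Hji, Hkj, Hki.
    assert (Hne : forall a b, dist2 (fst (f a)) (fst (f b)) = 1 -> lt a b \/ lt b a).
    { intros a b H. destruct (Ht a b) as [K|[K|K]]; auto.
      subst. rewrite dist2_refl in H. lra. }
    destruct (Hne _ _ Hij) as [K1|K1].
    + destruct (Hne _ _ Hjk) as [K2|K2].
      * apply (Hlast k i j); eauto.
      * apply (Hlast j i k); eauto.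
    + destruct (Hne _ _ Hik) as [K2|K2].
      * apply (Hlast k i j); eauto.
      * apply (Hlast i j k); eauto.
Qed.

(** An isometry carries the equilateral triangle [a], [b], [c] of side 1 to another one, which
    cannot lie in [B]. *)
Lemma unit_triangle_free_not_covering B :
  unit_triangle_free B -> ~ three_I_covering B.
Proof.
  intros HB H.
  set (a := (0, 0) : pt). set (b := (1, 0) : pt). set (c := (1 / 2, sqrt 3 / 2) : pt).
  assert (H3 : sqrt 3 * sqrt 3 = 3) by (apply sqrt_sqrt; lra).
  assert (Hd : forall p q, (fst p - fst q) ^ 2 + (snd p - snd q) ^ 2 = 1 -> dist2 p q = 1).
  { intros p q E. unfold dist2. rewrite E. apply sqrt_1. }
  assert (Hab : dist2 a b = 1) by (apply Hd; simpl; ring).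
  assert (Hbc : dist2 b c = 1) by (apply Hd; simpl; nra).
  assert (Hac : dist2 a c = 1) by (apply Hd; simpl; nra).
  assert (Hne : forall p q, dist2 p q = 1 -> p <> q).
  { intros p q E ->. rewrite dist2_refl in E. lra. }
  destruct (H (fun x => x = a \/ x = b \/ x = c)) as [phi [Hphi HC]].
  - exists a, b, c. repeat split; auto.
  - apply (HB (phi a) (phi b) (phi c)); auto. rewrite !Hphi. auto.
Qed.

Theorem mainTheorem17 :
  exists B : pt -> Prop, bernstein B /\ ~ three_I_covering B.
Proof.
  destruct exists_bernstein_unit_triangle_free as [B [HB HT]].
  exists B. split; [exact HB|]. apply unit_triangle_free_not_covering, HT.
Qed.
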